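(* Let $h_1,h_2\in\mathbb{C}$, $q=e^{h_1}$, $p=e^{h_2}$, $h=\frac{h_1+h_2}{2}\neq0$, $\phi=h_1/h$, $\varphi=h_2/h$. Let $M=\begin{pmatrix} x&\mu\\ \nu&y\end{pmatrix}\in\mathcal{M}_{h_1,h_2}$ and $T=\begin{pmatrix} a&\beta\\ \gamma&d\end{pmatrix}=e^{hM}$. Then $$a=e^{hx}-\frac{\mu\nu}{(x-y+\phi)(x-y-\varphi)}\left\{\left(\frac{\phi+pq\varphi}{2}-\frac{pq-1}{2}(x-y)\right)e^{hx}-p\,e^{hy}\right\},$$ $$d=e^{hy}-\frac{\nu\mu}{(x-y+\phi)(x-y-\varphi)}\left\{\left(\frac{\varphi+pq\phi}{2}+\frac{pq-1}{2}(x-y)\right)e^{hy}-q\,e^{hx}\right\},$$ $$\beta=\frac{\mu}{x-y+\phi}\left(q\,e^{hx}-e^{hy}\right),\qquad \gamma=\frac{\nu}{\varphi-(x-y)}\left(p\,e^{hy}-e^{hx}\right).$$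
   Context: Here $x,y,\mu,\nu$ are elements of a unital associative $\mathbb{C}$-algebra (in which the exponential series involved make sense), and $M\in\mathcal{M}_{h_1,h_2}$ means that they satisfy $$[x,\mu]=\phi\mu,\quad [y,\mu]=\phi\mu,\quad \mu^2=0,\quad [x,\nu]=\varphi\nu,\quad [y,\nu]=\varphi\nu,\quad \nu^2=0,\quad xy-yx=0,\quad \mu\nu+\nu\mu=0,$$ with $[u,v]=uv-vu$, $\phi=\frac{2h_1}{h_1+h_2}$, $\varphi=\frac{2h_2}{h_1+h_2}$. In these relations $x$ and $y$ commute and $x-y$ is central. The exponential is $e^{hM}=\sum_{n\ge0}\frac{h^n}{n!}M^n$. In the formulas, products are ordered with $\mu\nu$, $\nu\mu$, $\mu$, $\nu$ on the left; the quotients are power series in the commuting elements $x,y$ (the divisions of the functions of $x,y$ by the denominators are exact). *)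

(* Defs.v *)
From HB Require Import structures.
From mathcomp Require Import all_boot all_order all_algebra.
From mathcomp Require Import complex.
From mathcomp Require Import all_classical all_reals all_analysis.
Import Order.TTheory GRing.Theory Num.Theory.
Import numFieldNormedType.Exports.
Import Normc.

Set Implicit Arguments.
Unset Strict Implicit.
Unset Printing Implicit Defensive.

Local Open Scope classical_set_scope.
Local Open Scope ring_scope.

(* "An algebra in which the exponential series make sense" is read as a
   complete Hausdorff locally multiplicatively convex algebra (Arens-Michael
   algebra): the topology is given by a separating family [s] of
   submultiplicative seminorms, and Cauchy sequences converge.  In such an
   algebra every everywhere convergent power series can be evaluated at
   commuting elements.  Banach algebras are the case of a one-element family;
   finite-dimensional algebras are covered. *)

Section Convergence.
Variables (R : realType) (A : algType R[i]) (I : Type) (s : I -> A -> R).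

Definition converges_to (u : nat -> A) (l : A) : Prop :=
  forall i, (fun n => s i (u n - l)) @ \oo --> (0 : R).

Definition cauchy_sequence (u : nat -> A) : Prop :=
  forall i (e : R), 0 < e -> exists N : nat, forall m n : nat,
    (N <= m)%N -> (N <= n)%N -> s i (u m - u n) < e.

Record arens_michael : Prop := ArensMichael {
  am_triangle : forall i a b, s i (a + b) <= s i a + s i b;
  am_scale : forall i (k : R[i]) a, s i (k *: a) = normc k * s i a;
  am_submul : forall i a b, s i (a * b) <= s i a * s i b;
  am_separating : forall a, (forall i, s i a = 0) -> a = 0;
  am_complete : forall u, cauchy_sequence u -> exists l, converges_to u l
}.

(* Total sum of a series; meaningful only when the series converges, the sum
   being then unique since [s] is separating. *)
Definition series_sum (u : nat -> A) : A :=
  xget 0 [set l | converges_to (fun n => \sum_(k < n) u k) l].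

Definition alg_exp (a : A) : A :=
  series_sum (fun n => n`!%:R^-1 *: a ^+ n).

(* e^{hM} in M_2(A); convergence of matrices is entrywise. *)
Definition mx_exp (h : R[i]) (M : 'M[A]_2) : 'M[A]_2 :=
  \matrix_(i, j) series_sum (fun n => (h ^+ n / n`!%:R) *: (M ^+ n) i j).

Definition mx22 (a b c d : A) : 'M[A]_2 :=
  \matrix_(i, j) if i == 0 then if j == 0 then a else b
                 else if j == 0 then c else d.

Record in_M (h1 h2 : R[i]) (x mu nu y : A) : Prop := InM {
  comm_x_mu : x * mu - mu * x = (2 * h1 / (h1 + h2)) *: mu;
  comm_y_mu : y * mu - mu * y = (2 * h1 / (h1 + h2)) *: mu;
  mu_sqr : mu ^+ 2 = 0;
  comm_x_nu : x * nu - nu * x = (2 * h2 / (h1 + h2)) *: nu;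
  comm_y_nu : y * nu - nu * y = (2 * h2 / (h1 + h2)) *: nu;
  nu_sqr : nu ^+ 2 = 0;
  comm_x_y : x * y - y * x = 0;
  anticomm_mu_nu : mu * nu + nu * mu = 0
}.

End Convergence.

(* The field of complex numbers is an algebra over itself, normed by the
   modulus, so its exponential is an instance of [alg_exp]. *)
Definition cexp (R : realType) (z : R[i]) : R[i] :=
  alg_exp (A := R[i]^o) (fun (_ : unit) (w : R[i]^o) => normc (w : R[i])) z.

(* Formal power series in two commuting variables X, Y over the complex
   numbers: [f i j] is the coefficient of X^i Y^j. *)
Definition ps (R : realType) := nat -> nat -> R[i].

Declare Scope ps_scope.
Delimit Scope ps_scope with PS.
Bind Scope ps_scope with ps.

Section PowerSeries.
Variable R : realType.
Implicit Types f g : ps R.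

Definition ps_const (c : R[i]) : ps R :=
  fun i j => if (i == 0%N) && (j == 0%N) then c else 0.
Definition ps_X : ps R :=
  fun i j => if (i == 1%N) && (j == 0%N) then 1 else 0.
Definition ps_Y : ps R :=
  fun i j => if (i == 0%N) && (j == 1%N) then 1 else 0.
Definition ps_add f g : ps R := fun i j => f i j + g i j.
Definition ps_sub f g : ps R := fun i j => f i j - g i j.
Definition ps_mul f g : ps R := fun i j =>
  \sum_(k < i.+1) \sum_(l < j.+1) f k l * g (i - k)%N (j - l)%N.

(* e^{hX} and e^{hY} *)
Definition ps_expX (h : R[i]) : ps R :=
  fun i j => if j == 0%N then h ^+ i / i`!%:R else 0.
Definition ps_expY (h : R[i]) : ps R :=
  fun i j => if i == 0%N then h ^+ j / j`!%:R else 0.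

(* Exact division: C[[X, Y]] is an integral domain, so for g <> 0 there is at
   most one quotient.  The default value 0 is only used when the division is
   not exact. *)
Definition ps_div f g : ps R :=
  xget (fun _ _ => 0) [set Q : ps R | ps_mul g Q = f].

(* Value of f at commuting elements x, y, summed by total degree. *)
Definition ps_eval (A : algType R[i]) (I : Type) (s : I -> A -> R)
    (f : ps R) (x y : A) : A :=
  series_sum s (fun n =>
    \sum_(k < n.+1) f k (n - k)%N *: (x ^+ k * y ^+ (n - k))).

End PowerSeries.

Arguments ps_X {R}.
Arguments ps_Y {R}.

Notation "c %:PS" := (ps_const c) (format "c %:PS") : ring_scope.
Notation "f + g" := (ps_add f g) : ps_scope.
Notation "f - g" := (ps_sub f g) : ps_scope.
Notation "f * g" := (ps_mul f g) : ps_scope.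
Notation "f / g" := (ps_div f g) : ps_scope.

(* Main.v *)
Require Import Defs.
From HB Require Import structures.
From mathcomp Require Import all_boot all_order all_algebra.
From mathcomp Require Import complex.
From mathcomp Require Import all_classical all_reals all_analysis.
From mathcomp Require Import ring lra.
Import Order.TTheory GRing.Theory Num.Theory.
Import numFieldNormedType.Exports.
Import Normc.

(* The relations let mu and nu be moved to the left past x and y at the cost
   of shifting x and y by scalars, and words with three factors mu, nu vanish.
   Hence the entries of [M ^+ n] are x^n, y^n and the normally ordered terms
   mu B_n, nu C_n, mu nu A_n, nu mu D_n, where A_n, ..., D_n are values at (x, y)
   of complex polynomials given by affine recursions, i.e. divided differences
   of z^n at shifts of X and Y.  Multiplying them by the denominators gives
   combinations of powers such as (X + phi)^n and Y^n, whose exponential sums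
   are e^(h phi) e^(hX) and e^(hY); so their exponential sums are the formal
   quotients of the statement.  These quotients are not determined in [A], where
   x - y may be a zero divisor: they are identified coefficientwise in
   C[[X, Y]], and the resulting double series is evaluated in [A] by an
   interchange of summations justified by geometric growth of the
   coefficients. *)

Set Implicit Arguments.
Unset Strict Implicit.
Unset Printing Implicit Defensive.

Local Open Scope ring_scope.

(** * Convergence in an Arens-Michael algebra *)

Section ExpTail.
Variable R : realType.
Implicit Types C e : R.

(** Remainder of the real exponential series. The error estimates for exponential sums below are
    reduced to it. *)
Definition exp_tail C (N : nat) : R := expR C - \sum_(n < N) C ^+ n / n`!%:R.

Lemma expR_partial_cvg C e : 0 < e -> exists N : nat, forall n, (N <= n)%N ->
  `|expR C - \sum_(k < n) C ^+ k / k`!%:R| < e.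
Proof.
move=> e0; have /cvgrPdist_lt/(_ _ e0)[N _ HN] := @is_cvg_series_exp_coeff R C.
by exists N => n Nn; have := HN n Nn; rewrite /series/= big_mkord.
Qed.

(** The terms are nonnegative, so a partial sum is below every later one, and some later one is
    within [e] of the limit. *)
Lemma expR_partial_le C N : 0 <= C -> \sum_(n < N) C ^+ n / n`!%:R <= expR C.
Proof.
move=> C0; apply/ler_addgt0Pr => e /(expR_partial_cvg C)[M /(_ (maxn M N))].
rewrite leq_maxl => /(_ isT); rewrite distrC ltr_norml => /andP[_].
rewrite ltrBlDl => /ltW; apply: le_trans.
rewrite -!(big_mkord xpredT (fun n => C ^+ n / n`!%:R)).
rewrite (big_cat_nat (n := N) (p := maxn M N)) ?leq_maxr//=.
by rewrite lerDl sumr_ge0// => n _; rewrite divr_ge0// exprn_ge0.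
Qed.

Lemma exp_tail_ge C N M : 0 <= C -> (N <= M)%N ->
  \sum_(N <= n < M) C ^+ n / n`!%:R <= exp_tail C N.
Proof.
move=> C0 NM; rewrite /exp_tail lerBrDl.
rewrite -(big_mkord xpredT (fun n => C ^+ n / n`!%:R)) -big_cat_nat//.
by rewrite big_mkord expR_partial_le.
Qed.

Lemma exp_tail_cvg C e : 0 < e ->
  exists N : nat, forall n, (N <= n)%N -> exp_tail C n < e.
Proof.
move=> /(expR_partial_cvg C)[N HN]; exists N => n /HN.
by apply: le_lt_trans; rewrite ler_norm.
Qed.

End ExpTail.

Section Convergence.
Variables (R : realType) (A : algType R[i]) (I : Type) (s : I -> A -> R).
Implicit Types (u v : nat -> A) (a b l m : A).

Lemma converges_toP u l : converges_to s u l <->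
  forall i e, 0 < e -> exists N : nat, forall n, (N <= n)%N -> `|s i (u n - l)| < e.
Proof.
split=> [cu i e e0|cu i].
  have /cvgrPdist_lt/(_ _ e0)[N _ HN] := cu i.
  by exists N => n /HN; rewrite /= sub0r normrN.
apply/cvgrPdist_lt => e /(cu i)[N HN]; exists N => // n /HN.
by rewrite /= sub0r normrN.
Qed.

Hypothesis am : arens_michael s.

Lemma seminorm0 i : s i 0 = 0.
Proof. by rewrite -(scale0r (0 : A)) (am_scale am) normc0 mul0r. Qed.

Lemma seminormN i a : s i (- a) = s i a.
Proof. by rewrite -scaleN1r (am_scale am) normcN normc1 mul1r. Qed.

Lemma seminorm_ge0 i a : 0 <= s i a.
Proof.
by have := am_triangle am i a (- a); rewrite subrr seminorm0 seminormN; lra.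
Qed.

Lemma seminormB i a b : s i (a - b) = s i (b - a).
Proof. by rewrite -seminormN opprB. Qed.

Lemma seminorm_sum i (J : Type) (r : seq J) (P : pred J) (F : J -> A) :
  s i (\sum_(j <- r | P j) F j) <= \sum_(j <- r | P j) s i (F j).
Proof.
elim/big_ind2 : _ => [|a c b d ac bd|//]; first by rewrite seminorm0.
by rewrite (le_trans (am_triangle am _ _ _))// lerD.
Qed.

Lemma converges_to_le u l : converges_to s u l <->
  forall i e, 0 < e -> exists N : nat, forall n, (N <= n)%N -> s i (u n - l) < e.
Proof.
rewrite converges_toP; split=> cu i e /(cu i)[N HN]; exists N => n /HN;
  by rewrite ger0_norm ?seminorm_ge0.
Qed.

Lemma converges_to_dom u l v m :
  (forall i, exists2 k, 0 <= k & forall n, s i (v n - m) <= k * s i (u n - l)) ->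
  converges_to s u l -> converges_to s v m.
Proof.
move=> dom /converges_to_le cu; apply/converges_to_le => i e e0.
have [k k0 vu] := dom i.
have [N HN] := cu i (e / (k + 1)) (divr_gt0 e0 (ltr_wpDl k0 ltr01)).
exists N => n /HN; rewrite ltr_pdivlMr ?ltr_wpDl// => lte.
have := vu n; have := seminorm_ge0 i (u n - l); nra.
Qed.

Lemma converges_to_unique u l m :
  converges_to s u l -> converges_to s u m -> l = m.
Proof.
move=> /converges_to_le ul /converges_to_le um; apply/eqP; rewrite -subr_eq0.
apply/eqP/(am_separating am) => i; apply/eqP; rewrite eq_le seminorm_ge0 andbT.
apply/ler_addgt0Pr => e e0; rewrite add0r.
have [N1 H1] := ul i (e / 2) ltac:(lra).
have [N2 H2] := um i (e / 2) ltac:(lra).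
have {}H1 := H1 (maxn N1 N2) (leq_maxl _ _).
have {}H2 := H2 (maxn N1 N2) (leq_maxr _ _).
have := am_triangle am i (l - u (maxn N1 N2)) (u (maxn N1 N2) - m).
by rewrite addrA subrK (seminormB i l); lra.
Qed.

Lemma converges_to_eventually u v l : converges_to s u l ->
  (exists N : nat, forall n, (N <= n)%N -> u n = v n) -> converges_to s v l.
Proof.
move=> /converges_to_le ul [M uv]; apply/converges_to_le => i e /(ul i)[N HN].
exists (maxn M N) => n; rewrite geq_max => /andP[/uv <-]; exact: HN.
Qed.

Lemma converges_to_cst l : converges_to s (fun=> l) l.
Proof.
apply/converges_to_le => i e e0; exists 0%N => n _.
by rewrite subrr seminorm0.
Qed.

Lemma converges_toD u v l m : converges_to s u l -> converges_to s v m ->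
  converges_to s (fun n => u n + v n) (l + m).
Proof.
move=> /converges_to_le ul /converges_to_le vm; apply/converges_to_le => i e e0.
have [N1 H1] := ul i (e / 2) ltac:(lra).
have [N2 H2] := vm i (e / 2) ltac:(lra).
exists (maxn N1 N2) => n; rewrite geq_max => /andP[/H1 {}H1 /H2 {}H2].
by have := am_triangle am i (u n - l) (v n - m); rewrite addrACA -opprD; lra.
Qed.

Lemma converges_toMl a u l :
  converges_to s u l -> converges_to s (fun n => a * u n) (a * l).
Proof.
apply: converges_to_dom => i.
by exists (s i a) => [|n]; rewrite ?seminorm_ge0// -mulrBr (am_submul am).
Qed.

(** Scaling by [k] is left multiplication by [k%:A]. *)
Lemma converges_toZ (k : R[i]) u l :
  converges_to s u l -> converges_to s (fun n => k *: u n) (k *: l).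
Proof.
move=> /(converges_toMl k%:A); rewrite -scalerAl mul1r => cu.
by congr (converges_to _ _ _): cu; apply/funext => n; rewrite -scalerAl mul1r.
Qed.

Lemma converges_toN u l :
  converges_to s u l -> converges_to s (fun n => - u n) (- l).
Proof.
move=> /(converges_toZ (-1)); rewrite scaleN1r => cu.
by congr (converges_to _ _ _): cu; apply/funext => n; rewrite scaleN1r.
Qed.

Lemma converges_to_sum (J : Type) (r : seq J) (P : pred J)
    (u : J -> nat -> A) (l : J -> A) :
  (forall j, converges_to s (u j) (l j)) ->
  converges_to s (fun n => \sum_(j <- r | P j) u j n) (\sum_(j <- r | P j) l j).
Proof.
move=> ul; elim: r => [|j r IH].
  rewrite big_nil (_ : (fun _ => _) = fun=> 0); first exact: converges_to_cst.
  by apply/funext => n; rewrite big_nil.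
rewrite big_cons (_ : (fun _ => _) = fun n =>
    if P j then u j n + \sum_(j <- r | P j) u j n else \sum_(j <- r | P j) u j n);
  last by apply/funext => n; rewrite big_cons.
by case: ifP => // _; apply: converges_toD.
Qed.

Lemma converges_to_shift k u l :
  converges_to s u l -> converges_to s (fun n => u (n - k)%N) l.
Proof.
move=> /converges_to_le ul; apply/converges_to_le => i e /(ul i)[N HN].
by exists (N + k)%N => n Nkn; apply: HN; rewrite -(addnK k N) leq_sub2r.
Qed.

Lemma series_sumE u l :
  converges_to s (fun n => \sum_(k < n) u k) l -> series_sum s u = l.
Proof.
move=> ul; apply: xget_unique => // m um; exact: converges_to_unique um ul.
Qed.

(** Comparison with an exponential series makes the partial sums Cauchy. Both constants may depend
    on the seminorm. *)
Lemma exp_majorized_series u :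
  (forall i, exists K C, [/\ 0 <= K, 0 <= C &
     forall n, s i (u n) <= K * (C ^+ n / n`!%:R)]) ->
  exists l, converges_to s (fun n => \sum_(k < n) u k) l.
Proof.
move=> maj; apply: (am_complete am) => i e e0.
have [K [C [K0 C0 leu]]] := maj i.
(* Adding 1 keeps the denominator positive when [K] is 0. *)
have eK : 0 < e / (K + 1) by rewrite divr_gt0 ?ltr_wpDl.
have [N HN] := exp_tail_cvg C eK.
have key (m n : nat) : (N <= m)%N -> (m <= n)%N ->
    s i (\sum_(k < n) u k - \sum_(k < m) u k) < e.
  move=> Nm mn; rewrite -!(big_mkord xpredT u) (big_cat_nat (n := m) (p := n))//=.
  rewrite addrAC subrr add0r (le_lt_trans (seminorm_sum _ _ _ _))//.
  rewrite (le_lt_trans (ler_sum _ (fun k _ => leu k)))// -big_distrr/=.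
  have := exp_tail_ge C0 mn; have := HN m Nm; rewrite ltr_pdivlMr ?ltr_wpDl//.
  set S := (\sum_(_ <= _ < _) _); have S0 : 0 <= S.
    by apply: sumr_ge0 => k _; rewrite divr_ge0// exprn_ge0.
  by nra.
exists N => m n Nm Nn; have [mn|/ltnW nm] := leqP m n; last exact: key.
by rewrite seminormB; apply: key.
Qed.

End Convergence.

(** * The complex numbers as an Arens-Michael algebra *)

Section ComplexConvergence.
Variable R : realType.
Local Open Scope complex_scope.

(** This is the seminorm family built into [cexp], so convergence results for it apply to [cexp] and
    to coefficients of power series. *)
Definition cmodulus (i : unit) (w : R[i]^o) : R := normc (w : R[i]).

Lemma normc_ge0 (z : R[i]) : 0 <= normc z.
Proof. by case: z => a b; apply: sqrtr_ge0. Qed.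

(** Through this comparison the complex numbers inherit completeness from the reals. *)
Lemma normc_ReIm (z : R[i]) : [/\ `|complex.Re z| <= normc z, `|complex.Im z| <= normc z &
  normc z <= `|complex.Re z| + `|complex.Im z|].
Proof.
case: z => a b /=; have ab0 : 0 <= a ^+ 2 + b ^+ 2 by rewrite addr_ge0 ?sqr_ge0.
split.
- by rewrite -sqrtr_sqr ler_wsqrtr// lerDl sqr_ge0.
- by rewrite -sqrtr_sqr ler_wsqrtr// lerDr sqr_ge0.
- rewrite -[leRHS]ger0_norm ?addr_ge0// -sqrtr_sqr.
  rewrite ler_wsqrtr// sqrrD !real_normK ?num_real//.
  by rewrite lerD2r lerDl mulrn_wge0// mulr_ge0.
Qed.

Lemma real_cauchy_cvg (u : nat -> R) :
  (forall e, 0 < e -> exists N : nat, forall m n, (N <= m)%N -> (N <= n)%N ->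
    `|u m - u n| < e) ->
  exists l, forall e, 0 < e -> exists N : nat, forall n, (N <= n)%N -> `|u n - l| < e.
Proof.
move=> cu; have : cvgn u.
  apply/cauchy_cvgP/cauchy_ballP => e e0.
  have [N HN] := cu e e0.
  (* Both sets of the pair are the image of the tail from [N] on, whose points are pairwise
     [e]-close. *)
  exists ([set u n | n in [set n | (N <= n)%N]], [set u n | n in [set n | (N <= n)%N]])%classic.
    by split; exists N => // n /= Nn; exists n.
  by move=> [_ _] /= [[m Nm <-] [n Nn <-]]; rewrite /ball/=; apply: HN.
case/cvg_ex => l /cvgrPdist_lt ul; exists l => e /ul[N _ HN].
by exists N => n /HN; rewrite /= distrC.
Qed.

Lemma cmodulus_arens_michael : arens_michael cmodulus.
Proof.
split.
- by move=> i a b; apply: le_normcD.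
- by move=> i k a; apply: normcM.
- by move=> i a b; rewrite /cmodulus normcM.
- by move=> a a0; apply: eq0_normc; apply: a0 tt.
- move=> u cu.
  have [|a ua] := @real_cauchy_cvg (fun n => complex.Re (u n : R[i])).
    move=> e e0; have [N HN] := cu tt e e0; exists N => m n Nm Nn.
    rewrite -raddfB; apply: le_lt_trans (HN m n Nm Nn).
    by have [] := normc_ReIm (u m - u n).
  have [|b ub] := @real_cauchy_cvg (fun n => complex.Im (u n : R[i])).
    move=> e e0; have [N HN] := cu tt e e0; exists N => m n Nm Nn.
    rewrite -raddfB; apply: le_lt_trans (HN m n Nm Nn).
    by have [] := normc_ReIm (u m - u n).
  exists (a +i* b : R[i]); apply/converges_toP => i e e0.
  have [N1 H1] := ua (e / 2) ltac:(lra).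
  have [N2 H2] := ub (e / 2) ltac:(lra).
  exists (maxn N1 N2) => n; rewrite geq_max => /andP[/H1 {}H1 /H2 {}H2].
  have [_ _] := normc_ReIm (u n - (a +i* b)).
  rewrite !raddfB/= /cmodulus (ger0_norm (normc_ge0 _)).
  by rewrite /cmodulus; lra.
Qed.

End ComplexConvergence.

(** * Exact division of formal power series *)

Section Polynomials.
Variable R : realType.
Notation C := R[i].
Implicit Types (P Q : {poly {poly C}}) (f g : ps R).

(* A polynomial in X and Y is a polynomial in Y with coefficients in C[X]. *)
Definition ps_of_poly P : ps R := fun i j => P`_j`_i.

Definition polX : {poly {poly C}} := 'X%:P.
Definition polY : {poly {poly C}} := 'X.
Definition polC (c : C) : {poly {poly C}} := c%:P%:P.

Lemma coef_polXM P i j :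
  (polX * P)`_j`_i = if i is i'.+1 then P`_j`_i' else 0.
Proof. by rewrite coefCM coefXM; case: i. Qed.

Lemma coef_polYM P i j :
  (polY * P)`_j`_i = if j is j'.+1 then P`_j'`_i else 0.
Proof. by rewrite coefXM; case: j => //=; rewrite coef0. Qed.

Lemma coef_polCM c P i j : (polC c * P)`_j`_i = c * P`_j`_i.
Proof. by rewrite !coefCM. Qed.

Lemma polC0 : polC 0 = 0.
Proof. by rewrite /polC !rmorph0. Qed.

Lemma polC1 : polC 1 = 1.
Proof. by rewrite /polC !rmorph1. Qed.

Lemma polCD c d : polC (c + d) = polC c + polC d.
Proof. by rewrite /polC !rmorphD. Qed.

Lemma polCM c d : polC (c * d) = polC c * polC d.
Proof. by rewrite /polC !rmorphM. Qed.

Lemma polCN c : polC (- c) = - polC c.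
Proof. by rewrite /polC !rmorphN. Qed.

Lemma ps_of_polyM P Q :
  ps_of_poly (P * Q) = ps_mul (ps_of_poly P) (ps_of_poly Q).
Proof.
apply/funext => i; apply/funext => j; rewrite /ps_of_poly /ps_mul coefM coef_sum.
by under eq_bigr do rewrite coefM; rewrite exchange_big.
Qed.

Lemma ps_of_polyD P Q : ps_of_poly (P + Q) = ps_add (ps_of_poly P) (ps_of_poly Q).
Proof. by apply/funext => i; apply/funext => j; rewrite /ps_of_poly !coefD. Qed.

Lemma ps_of_polyB P Q : ps_of_poly (P - Q) = ps_sub (ps_of_poly P) (ps_of_poly Q).
Proof. by apply/funext => i; apply/funext => j; rewrite /ps_of_poly !coefB. Qed.

Lemma ps_of_polC c : ps_of_poly (polC c) = ps_const c.
Proof.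
apply/funext => i; apply/funext => j; rewrite /ps_of_poly /polC /ps_const coefC.
by case: j => [|j]; rewrite ?coefC ?coef0 ?andbT ?andbF ?if_same.
Qed.

Lemma ps_of_polX : ps_of_poly polX = ps_X.
Proof.
apply/funext => i; apply/funext => j; rewrite /ps_of_poly /polX /ps_X coefC.
by case: j => [|j]; rewrite ?coefX ?coef0 ?andbT ?andbF//=; case: (i == 1%N).
Qed.

Lemma ps_of_polY : ps_of_poly polY = ps_Y.
Proof.
apply/funext => i; apply/funext => j; rewrite /ps_of_poly /polY /ps_Y.
by rewrite coefX coefMn coef1; case: (i == 0%N); case: (j == 1%N).
Qed.

(** The coefficient of a product at (i, j) involves only coefficients of index at most i and j.
    Truncation thus moves identities about products into the ring of polynomials. *)
Definition ps_trunc N f : {poly {poly C}} := \poly_(j < N) \poly_(i < N) f i j.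

Lemma coef_ps_trunc N f i j : (i < N)%N -> (j < N)%N -> (ps_trunc N f)`_j`_i = f i j.
Proof. by move=> iN jN; rewrite !coef_poly jN coef_poly iN. Qed.

Lemma ps_mul_trunc N P f i j : (i < N)%N -> (j < N)%N ->
  ps_mul (ps_of_poly P) f i j = (P * ps_trunc N f)`_j`_i.
Proof.
move=> iN jN; rewrite -[RHS]/(ps_of_poly _ i j) ps_of_polyM.
apply: eq_bigr => k _; apply: eq_bigr => l _.
by rewrite [in RHS]/ps_of_poly coef_ps_trunc// (leq_ltn_trans (leq_subr _ _)).
Qed.

(** Associativity is inherited from polynomials by truncating [f] beyond the coefficient under
    consideration. *)
Lemma ps_mulA P Q f : ps_mul (ps_of_poly (P * Q)) f =
  ps_mul (ps_of_poly P) (ps_mul (ps_of_poly Q) f).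
Proof.
apply/funext => i; apply/funext => j; set N := (maxn i j).+1.
have iN : (i < N)%N by rewrite ltnS leq_maxl.
have jN : (j < N)%N by rewrite ltnS leq_maxr.
rewrite (ps_mul_trunc _ _ iN jN) -mulrA -[LHS]/(ps_of_poly _ i j) ps_of_polyM.
apply: eq_bigr => k _; apply: eq_bigr => l _.
by rewrite (@ps_mul_trunc N) ?(leq_ltn_trans (leq_subr _ _)).
Qed.

Lemma ps_mulBr f g1 g2 i j :
  ps_mul f (ps_sub g1 g2) i j = ps_mul f g1 i j - ps_mul f g2 i j.
Proof.
rewrite /ps_mul -sumrB; apply: eq_bigr => k _; rewrite -sumrB.
by apply: eq_bigr => l _; rewrite mulrBr.
Qed.

(** [P] is not a zero divisor among power series, which is what makes a quotient by [P] unique. *)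
Definition ps_regular P := forall f,
  (forall i j, ps_mul (ps_of_poly P) f i j = 0) -> forall i j, f i j = 0.

Lemma ps_div_unique P f g : ps_regular P ->
  ps_mul (ps_of_poly P) g = f -> ps_div f (ps_of_poly P) = g.
Proof.
move=> regP Pg; apply: xget_unique => // g' /= Pg'.
apply/funext => i; apply/funext => j; apply/eqP; rewrite -subr_eq0; apply/eqP.
by apply: (regP (ps_sub g' g)) => k l; rewrite ps_mulBr Pg Pg' subrr.
Qed.

Lemma ps_regularM P Q : ps_regular P -> ps_regular Q -> ps_regular (P * Q).
Proof. by move=> rP rQ f PQf; apply: rQ; apply: rP => i j; rewrite -ps_mulA. Qed.

(** Every factor of the denominators has this form, with [e] equal to 1 or -1. The constant [c] is
    zero when the corresponding [h1] or [h2] is. If it is zero, coefficients are constant along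
    antidiagonals and vanish at the end j = 0; otherwise the recurrence determines them by induction
    on the total degree. *)
Lemma ps_regular_linear e c : e != 0 -> ps_regular (polC e * (polX - polY) + polC c).
Proof.
move=> e0 f Lf.
have rec i j : e * ((if i is i'.+1 then f i' j else 0) -
    (if j is j'.+1 then f i j' else 0)) + c * f i j = 0.
  have iN : (i < (maxn i j).+1)%N by rewrite ltnS leq_maxl.
  have jN : (j < (maxn i j).+1)%N by rewrite ltnS leq_maxr.
  have := Lf i j; rewrite (ps_mul_trunc _ _ iN jN) mulrDl -mulrA !coefD !coef_polCM.
  rewrite mulrBl !coefB coef_polXM coef_polYM coef_ps_trunc//.
  by case: i j iN jN => [|i] [|j] iN jN; rewrite ?coef_ps_trunc// ltnW.
have [c0|c0] := eqVneq c 0.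
  have shift i j : f i j = if j is j'.+1 then f i.+1 j' else 0.
    by have /eqP := rec i.+1 j; rewrite c0 mul0r addr0 mulf_eq0 (negPf e0) subr_eq0 => /eqP.
  by move=> i j; elim: j i => [|j IH] i; rewrite shift.
suff vanish n i j : (i + j < n)%N -> f i j = 0 by move=> i j; exact: (vanish _ _ _ (ltnSn _)).
elim: n i j => // n IH i j; rewrite ltnS => ijn; have /eqP := rec i j.
rewrite [if i is _.+1 then _ else _](_ : _ = 0); last first.
  by case: i ijn => // i ijn; apply: IH.
rewrite [if j is _.+1 then _ else _](_ : _ = 0); last first.
  by case: j ijn => // j; rewrite addnS => ijn; apply: IH.
by rewrite subrr mulr0 add0r mulf_eq0 (negPf c0) => /eqP.
Qed.

End Polynomials.

(** * Norms and values of polynomials, summed by total degree *)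

Section TriangularSums.
Variable V : zmodType.
Implicit Types F G : nat -> nat -> V.

(** Same order of summation as in [ps_eval], stopped before total degree [D]. *)
Definition tri_sum D F : V := \sum_(d < D) \sum_(k < d.+1) F k (d - k)%N.

Lemma eq_tri_sum D F G : (forall i j, F i j = G i j) -> tri_sum D F = tri_sum D G.
Proof. by move=> FG; apply: eq_bigr => d _; apply: eq_bigr. Qed.

Lemma tri_sumD D F G :
  tri_sum D (fun i j => F i j + G i j) = tri_sum D F + tri_sum D G.
Proof. by rewrite -big_split; apply: eq_bigr => d _; rewrite big_split. Qed.

Lemma tri_sum_shiftX D F : (forall j, F 0%N j = 0) ->
  tri_sum D.+1 F = tri_sum D (fun i j => F i.+1 j).
Proof.
move=> F0; rewrite /tri_sum big_ord_recl big_ord1 F0 add0r.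
by apply: eq_bigr => d _; rewrite big_ord_recl F0 add0r.
Qed.

Lemma tri_sum_shiftY D F : (forall i, F i 0%N = 0) ->
  tri_sum D.+1 F = tri_sum D (fun i j => F i j.+1).
Proof.
move=> F0; rewrite /tri_sum big_ord_recl big_ord1 F0 add0r.
apply: eq_bigr => d _; rewrite big_ord_recr/= /bump/= add1n subnn F0 addr0.
by apply: eq_bigr => k _; rewrite subSn// -ltnS.
Qed.

End TriangularSums.

Section PowerSeriesNorm.
Variable R : realType.
Notation C := R[i].
Notation X := (polX R).
Notation Y := (polY R).
Implicit Types (P Q : {poly {poly C}}) (f g : ps R) (r : R).

(** Weighted l1 norm at radius [r], cut off at total degree [D]. Bounds that are uniform in [D]
    replace the summability of the whole series. *)
Definition ps_norm r D f : R := tri_sum D (fun i j => normc (f i j) * r ^+ (i + j)).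

Lemma le_tri_sum D (F G : nat -> nat -> R) : (forall i j, F i j <= G i j) ->
  tri_sum D F <= tri_sum D G.
Proof. by move=> FG; apply: ler_sum => d _; apply: ler_sum. Qed.

Lemma tri_sum_ge0 D (F : nat -> nat -> R) : (forall i j, 0 <= F i j) ->
  0 <= tri_sum D F.
Proof. by move=> F0; apply: sumr_ge0 => d _; apply: sumr_ge0. Qed.

Lemma tri_sum_leS D (F : nat -> nat -> R) : (forall i j, 0 <= F i j) ->
  tri_sum D F <= tri_sum D.+1 F.
Proof. by move=> F0; rewrite [leRHS]big_ord_recr lerDl sumr_ge0. Qed.

Lemma tri_sumZ D (k : R) F : tri_sum D (fun i j => k * F i j) = k * tri_sum D F.
Proof. by rewrite mulr_sumr; apply: eq_bigr => d _; rewrite mulr_sumr. Qed.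

Lemma ps_norm_ge0 r D f : 0 <= r -> 0 <= ps_norm r D f.
Proof.
by move=> r0; apply: tri_sum_ge0 => i j; rewrite mulr_ge0 ?normc_ge0 ?exprn_ge0.
Qed.

Lemma ps_norm0 r D P : P = 0 -> ps_norm r D (ps_of_poly P) = 0.
Proof.
move=> ->; rewrite /ps_norm /tri_sum big1// => d _; rewrite big1// => k _.
by rewrite /ps_of_poly !coef0 normc0 mul0r.
Qed.

Lemma ps_normD r D P Q : 0 <= r ->
  ps_norm r D (ps_of_poly (P + Q)) <= ps_norm r D (ps_of_poly P) + ps_norm r D (ps_of_poly Q).
Proof.
move=> r0; rewrite -tri_sumD; apply: le_tri_sum => i j.
by rewrite -mulrDl ler_wpM2r ?exprn_ge0// /ps_of_poly !coefD le_normcD.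
Qed.

Lemma ps_norm_polC r D c P : 
  ps_norm r D (ps_of_poly (polC c * P)) = normc c * ps_norm r D (ps_of_poly P).
Proof.
rewrite -tri_sumZ; apply: eq_tri_sum => i j.
by rewrite mulrA /ps_of_poly coef_polCM normcM.
Qed.

Lemma ps_norm_polX r D P : 0 <= r ->
  ps_norm r D (ps_of_poly (X * P)) <= r * ps_norm r D (ps_of_poly P).
Proof.
move=> r0; have pos f i j : 0 <= normc (f i j) * r ^+ (i + j) :> R.
  by rewrite mulr_ge0 ?normc_ge0 ?exprn_ge0.
(* Passing to [D.+1] only increases the sum, and multiplication by X then shifts it exactly onto
   degrees below [D]. *)
apply: le_trans (tri_sum_leS _ (pos _)) _; rewrite tri_sum_shiftX; last first.
  by move=> j; rewrite /ps_of_poly coef_polXM normc0 mul0r.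
rewrite -tri_sumZ; apply: le_tri_sum => i j.
by rewrite /ps_of_poly coef_polXM addSn exprS mulrCA.
Qed.

Lemma ps_norm_polY r D P : 0 <= r ->
  ps_norm r D (ps_of_poly (Y * P)) <= r * ps_norm r D (ps_of_poly P).
Proof.
move=> r0; have pos f i j : 0 <= normc (f i j) * r ^+ (i + j) :> R.
  by rewrite mulr_ge0 ?normc_ge0 ?exprn_ge0.
apply: le_trans (tri_sum_leS _ (pos _)) _; rewrite tri_sum_shiftY; last first.
  by move=> j; rewrite /ps_of_poly coef_polYM normc0 mul0r.
rewrite -tri_sumZ; apply: le_tri_sum => i j.
by rewrite /ps_of_poly coef_polYM addnS exprS mulrCA.
Qed.

Lemma coef_le_ps_norm f i j : normc (f i j) <= ps_norm 1 (i + j).+1 f.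
Proof.
have pos k l : 0 <= normc (f k l) * 1 ^+ (k + l) :> R.
  by rewrite expr1n mulr1 normc_ge0.
rewrite /ps_norm /tri_sum big_ord_recr/=.
have iij : (i < (i + j).+1)%N by rewrite ltnS leq_addr.
rewrite (bigD1 (Ordinal iij))//= addKn expr1n mulr1.
by rewrite addrCA lerDl addr_ge0 ?(tri_sum_ge0 _ pos)// sumr_ge0.
Qed.

Definition mul_bounded P := forall r, 0 <= r -> exists2 k : R, 0 <= k &
  forall D Q, ps_norm r D (ps_of_poly (P * Q)) <= k * ps_norm r D (ps_of_poly Q).

Lemma mul_boundedDC P c : mul_bounded P -> mul_bounded (P + polC c).
Proof.
move=> bP r r0; have [k k0 Pk] := bP r r0.
exists (k + normc c) => [|D Q]; first by rewrite addr_ge0 ?normc_ge0.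
by rewrite !mulrDl (le_trans (ps_normD _ _ _ r0))// ps_norm_polC lerD2r.
Qed.

Lemma mul_bounded_polX : mul_bounded X.
Proof. by move=> r r0; exists r => // D Q; apply: ps_norm_polX. Qed.

Lemma mul_bounded_polY : mul_bounded Y.
Proof. by move=> r r0; exists r => // D Q; apply: ps_norm_polY. Qed.

(** Since [k] is independent of [D], the series of the h^n/n! [u n] is dominated at every radius by
    an exponential series. *)
Definition geometric_growth (u : nat -> {poly {poly C}}) :=
  forall r, 0 <= r -> exists2 k : R, 0 <= k &
    forall n D, ps_norm r D (ps_of_poly (u n)) <= k ^+ n.

Lemma ps_of_poly1 i j : ps_of_poly 1 i j = ((i == 0%N) && (j == 0%N))%:R :> C.
Proof.
by rewrite /ps_of_poly coef1 coefMn coef1; case: (i == 0%N); case: (j == 0%N).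
Qed.

Lemma ps_norm1 r D : ps_norm r D (ps_of_poly 1) <= 1.
Proof.
case: D => [|D]; first by rewrite /ps_norm /tri_sum big_ord0.
rewrite /ps_norm /tri_sum big_ord_recl big_ord1 big1 => [|d _]; last first.
  have kd (k : 'I_(lift ord0 d).+1) : (k <= lift ord0 d)%N by rewrite -ltnS.
  apply: big1 => k _; rewrite ps_of_poly1 -addn_eq0 (subnKC (kd k)).
  by rewrite [X in normc X](_ : _ = 0) ?normc0 ?mul0r.
by rewrite addr0 subnn expr0 mulr1 ps_of_poly1 [X in normc X](_ : _ = 1) ?normc1.
Qed.

Lemma geometric_growthX P : mul_bounded P -> geometric_growth (fun n => P ^+ n).
Proof.
move=> bP r r0; have [k k0 Pk] := bP r r0; exists k => // n D.
elim: n => [|n IH]; first by rewrite expr0 expr0 ps_norm1.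
by rewrite !exprS (le_trans (Pk _ _))// ler_wpM2l.
Qed.

End PowerSeriesNorm.

(* [affine_iter a (GRing.exp b) n] is the sum of the a^k b^l for k + l = n - 1. *)
Fixpoint affine_iter (S : pzRingType) (a : S) (u : nat -> S) n : S :=
  if n is m.+1 then a * affine_iter a u m + u m else 0.

Section Evaluation.
Variable R : realType.
Notation C := R[i].
Notation X := (polX R).
Notation Y := (polY R).
Implicit Types (P Q : {poly {poly C}}) (f g : ps R) (r : R).

Lemma geometric_growth_affine_iter P u : mul_bounded P -> geometric_growth u ->
  geometric_growth (affine_iter P u).
Proof.
move=> bP gu r r0; have [k k0 Pk] := bP r r0; have [l l0 ul] := gu r r0.
(* The summand [l] makes this base dominate [l ^+ n], and the summand 1 absorbs the term added at
   each step of the recursion. *)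
exists (k + l + 1) => [|n D]; first by rewrite !addr_ge0.
elim: n => [|n IH] /=; first by rewrite expr0 ps_norm0.
rewrite (le_trans (ps_normD _ _ _ r0))// exprS.
have := Pk D (affine_iter P u n); have := ul n D.
have le_ln : l ^+ n <= (k + l + 1) ^+ n by rewrite lerXn2r ?nnegrE ?addr_ge0//; lra.
have := exprn_ge0 n l0; nra.
Qed.

Variables (A : algType C) (x y : A).

Definition ps_partial D f : A := tri_sum D (fun i j => f i j *: (x ^+ i * y ^+ j)).

(** The partial sums of a polynomial by total degree become constant. Taking this constant as the
    value keeps it comparable with partial sums of power series. *)
Definition poly_value P a := exists D0, forall D, (D0 <= D)%N ->
  ps_partial D (ps_of_poly P) = a.

Lemma poly_value1 : poly_value 1 1.
Proof.
exists 1%N => -[|D]// _; rewrite /ps_partial /tri_sum big_ord_recl big_ord1.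
rewrite subnn big1 => [|d _].
  by rewrite ps_of_poly1 !expr0 mulr1 scale1r addr0.
have kd (k : 'I_(lift ord0 d).+1) : (k <= lift ord0 d)%N by rewrite -ltnS.
apply: big1 => k _; rewrite ps_of_poly1 -addn_eq0 (subnKC (kd k)).
by rewrite [X in X *: _](_ : _ = 0) ?scale0r.
Qed.

Lemma poly_value0 : poly_value 0 0.
Proof.
exists 0%N => D _; apply: big1 => d _; apply: big1 => k _.
by rewrite /ps_of_poly !coef0 scale0r.
Qed.

Lemma poly_valueD P Q a b :
  poly_value P a -> poly_value Q b -> poly_value (P + Q) (a + b).
Proof.
move=> [D1 H1] [D2 H2]; exists (maxn D1 D2) => D.
rewrite geq_max => /andP[/H1<- /H2<-]; rewrite -tri_sumD; apply: eq_tri_sum => i j.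
by rewrite /ps_of_poly !coefD scalerDl.
Qed.

Lemma poly_value_polC c P a : poly_value P a -> poly_value (polC c * P) (c *: a).
Proof.
move=> [D1 H1]; exists D1 => D /H1<-; rewrite scaler_sumr; apply: eq_bigr => d _.
rewrite scaler_sumr; apply: eq_bigr => k _.
by rewrite /ps_of_poly coef_polCM scalerA.
Qed.

Lemma poly_value_polX P a : poly_value P a -> poly_value (X * P) (x * a).
Proof.
move=> [D1 H1]; exists D1.+1 => -[|D]//; rewrite ltnS => /H1<-.
rewrite /ps_partial tri_sum_shiftX => [|j]; last first.
  by rewrite /ps_of_poly coef_polXM scale0r.
rewrite mulr_sumr; apply: eq_bigr => d _; rewrite mulr_sumr; apply: eq_bigr => k _.
by rewrite /ps_of_poly coef_polXM exprS -mulrA scalerAr.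
Qed.

Hypothesis xy : x * y = y * x.

Lemma poly_value_polY P a : poly_value P a -> poly_value (Y * P) (y * a).
Proof.
move=> [D1 H1]; exists D1.+1 => -[|D]//; rewrite ltnS => /H1<-.
rewrite /ps_partial tri_sum_shiftY => [|j]; last first.
  by rewrite /ps_of_poly coef_polYM scale0r.
rewrite mulr_sumr; apply: eq_bigr => d _; rewrite mulr_sumr; apply: eq_bigr => k _.
rewrite /ps_of_poly coef_polYM exprS -scalerAr !mulrA; congr (_ *: (_ * _)).
(* In normal order the powers of [x] come first, so [y] must be moved past them. *)
by apply/esym/commrX.
Qed.

(** Multiplicativity of evaluation, expressed as a property of the left factor; it is established
    for X, Y and their shifts by scalars. *)
Definition mul_value P a := forall Q b, poly_value Q b -> poly_value (P * Q) (a * b).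

Lemma mul_valueX : mul_value X x.
Proof. exact: poly_value_polX. Qed.

Lemma mul_valueY : mul_value Y y.
Proof. exact: poly_value_polY. Qed.

Lemma mul_valueDC c P a : mul_value P a -> mul_value (P + polC c) (a + c%:A).
Proof.
move=> Pa Q b Qb; rewrite (mulrDl P) (mulrDl a) -(scalerAl c 1 b) (mul1r b).
by apply: poly_valueD; [apply: Pa|apply: poly_value_polC].
Qed.

Lemma poly_value_exp P a n : mul_value P a -> poly_value (P ^+ n) (a ^+ n).
Proof.
move=> Pa; elim: n => [|n IH]; first exact: poly_value1.
by rewrite !exprS; apply: Pa.
Qed.

Lemma poly_value_affine_iter P a (u : nat -> {poly {poly C}}) (w : nat -> A) n :
  mul_value P a -> (forall m, poly_value (u m) (w m)) ->
  poly_value (affine_iter P u n) (affine_iter a w n).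
Proof.
move=> Pa uw; elim: n => [|n IH] /=; first exact: poly_value0.
by apply: poly_valueD; first exact: Pa.
Qed.

End Evaluation.

(** * Exponential sums of polynomials *)

Section ExponentialSums.
Variable R : realType.
Notation C := R[i].
Implicit Types (P Q : {poly {poly C}}) (f g : ps R) (r : R).

Lemma normc_exp_coef (h : C) n : normc (h ^+ n / n`!%:R) = normc h ^+ n / n`!%:R.
Proof.
rewrite normcM normcV; congr (_ * _^-1).
  by elim: n => [|n IH]; rewrite ?expr0 ?normc1// !exprS normcM IH.
by rewrite -[n`!%:R]/(1 *+ n`!) normcMn normc1.
Qed.

Definition ps_lim (u : nat -> ps R) f :=
  forall i j, converges_to (@cmodulus R) (fun N => u N i j : R[i]^o) (f i j).

Definition exp_sum (h : C) (u : nat -> {poly {poly C}}) N : {poly {poly C}} :=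
  \sum_(n < N) polC (h ^+ n / n`!%:R) * u n.

Lemma coef_exp_sum h u N i j :
  (exp_sum h u N)`_j`_i = \sum_(n < N) h ^+ n / n`!%:R * (u n)`_j`_i.
Proof. by rewrite /exp_sum !coef_sum; apply: eq_bigr => n _; rewrite coef_polCM. Qed.

Lemma ps_norm_sum r D (J : Type) (s : seq J) (F : J -> {poly {poly C}}) : 0 <= r ->
  ps_norm r D (ps_of_poly (\sum_(j <- s) F j)) <=
  \sum_(j <- s) ps_norm r D (ps_of_poly (F j)).
Proof.
move=> r0; elim: s => [|j s IH]; first by rewrite !big_nil ps_norm0.
by rewrite !big_cons (le_trans (ps_normD _ _ _ r0))// lerD2l.
Qed.

Lemma ps_lim_exp_sum h u : geometric_growth u ->
  exists f, ps_lim (fun N => ps_of_poly (exp_sum h u N)) f.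
Proof.
move=> gu.
exists (fun i j => series_sum (@cmodulus R)
  (fun n => h ^+ n / n`!%:R * (u n)`_j`_i : R[i]^o)) => i j.
have [|l ul] := exp_majorized_series (@cmodulus_arens_michael R)
    (u := fun n => h ^+ n / n`!%:R * (u n)`_j`_i : R[i]^o).
  (* At radius 1 the norm bounds the modulus of each single coefficient. *)
  move=> t; have [k k0 uk] := gu 1 ler01.
  exists 1, (normc h * k); split=> // [|n]; first by rewrite mulr_ge0 ?normc_ge0.
  rewrite /cmodulus normcM normc_exp_coef mul1r exprMn mulrAC.
  rewrite ler_wpM2r ?invr_ge0// ler_wpM2l ?exprn_ge0 ?normc_ge0//.
  exact: le_trans (coef_le_ps_norm (ps_of_poly (u n)) i j) (uk _ _).
rewrite (series_sumE (@cmodulus_arens_michael R) ul).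
by congr (converges_to _ _ _): ul; apply/funext => N; rewrite -coef_exp_sum.
Qed.

Definition eventually_small (v : nat -> R) := forall e, 0 < e ->
  exists N : nat, forall n, (N <= n)%N -> v n < e.

Lemma eventually_small_sum D (v : nat -> nat -> R) :
  (forall d, eventually_small (v d)) ->
  eventually_small (fun n => \sum_(d < D) v d n).
Proof.
move=> vs; elim: D => [|D IH] e e0; first by exists 0%N => n _; rewrite big_ord0.
have [N1 H1] := IH (e / 2) ltac:(lra).
have [N2 H2] := vs D (e / 2) ltac:(lra).
exists (maxn N1 N2) => n; rewrite geq_max big_ord_recr/= => /andP[/H1 {}H1 /H2 {}H2].
lra.
Qed.

(** For fixed [D] the norm is a finite sum over coefficients, so coefficientwise convergence
    suffices. *)
Lemma ps_norm_lim u f r D : 0 <= r -> ps_lim u f ->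
  eventually_small (fun n => ps_norm r D (ps_sub f (u n))).
Proof.
move=> r0 uf; apply: (@eventually_small_sum D
  (fun d n => \sum_(k < d.+1) normc (f k (d - k)%N - u n k (d - k)%N) * r ^+ (k + (d - k)))).
move=> d; apply: (@eventually_small_sum d.+1
  (fun k n => normc (f k (d - k)%N - u n k (d - k)%N) * r ^+ (k + (d - k)))).
move=> k e e0; have := uf k (d - k)%N.
move=> /(converges_to_le (@cmodulus_arens_michael R)) /(_ tt).
have rk0 : 0 <= r ^+ (k + (d - k)) by rewrite exprn_ge0.
move=> /(_ (e / (r ^+ (k + (d - k)) + 1))); rewrite divr_gt0 ?ltr_wpDl// => /(_ isT)[N HN].
exists N => n /HN; rewrite ltr_pdivlMr ?ltr_wpDl//.
rewrite (seminormB (@cmodulus_arens_michael R)) /cmodulus.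
by have := normc_ge0 (f k (d - k)%N - u n k (d - k)%N); nra.
Qed.

(** The bound is uniform in [D]. For fixed [D] the limit is replaced, up to [e], by a later partial
    sum, and the block between the two partial sums is bounded by an exponential tail. *)
Lemma exp_sum_tail h u r k f D N : 0 <= r -> 0 <= k ->
  (forall n D, ps_norm r D (ps_of_poly (u n)) <= k ^+ n) ->
  ps_lim (fun N => ps_of_poly (exp_sum h u N)) f ->
  ps_norm r D (ps_sub f (ps_of_poly (exp_sum h u N))) <= exp_tail (normc h * k) N.
Proof.
move=> r0 k0 uk uf; apply/ler_addgt0Pr => e e0.
have [M HM] := ps_norm_lim D r0 uf e0.
have := HM (maxn M N) (leq_maxl _ _).
have NM : (N <= maxn M N)%N by rewrite leq_maxr.
set S := \sum_(N <= n < maxn M N) polC (h ^+ n / n`!%:R) * u n.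
have SE : exp_sum h u (maxn M N) = exp_sum h u N + S.
  rewrite /exp_sum /S -!(big_mkord xpredT (fun n => polC (h ^+ n / n`!%:R) * u n)).
  by rewrite -big_cat_nat.
have : ps_norm r D (ps_of_poly S) <= exp_tail (normc h * k) N.
  apply: le_trans (exp_tail_ge _ NM); last by rewrite mulr_ge0 ?normc_ge0.
  rewrite (le_trans (ps_norm_sum _ _ _ r0))//; apply: ler_sum => n _.
  rewrite ps_norm_polC normc_exp_coef exprMn mulrAC.
  by rewrite ler_wpM2r ?invr_ge0// ler_wpM2l ?exprn_ge0 ?normc_ge0.
suff : ps_norm r D (ps_sub f (ps_of_poly (exp_sum h u N))) <=
  ps_norm r D (ps_sub f (ps_of_poly (exp_sum h u (maxn M N)))) +
  ps_norm r D (ps_of_poly S) by lra.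
rewrite -tri_sumD; apply: le_tri_sum => i j; rewrite -mulrDl ler_wpM2r ?exprn_ge0//.
rewrite SE /ps_sub /ps_of_poly !coefD; apply: le_trans (le_normcD _ _).
by rewrite opprD addrA subrK.
Qed.

Variables (A : algType C) (I : Type) (s : I -> A -> R) (x y : A).
Hypothesis am : arens_michael s.

(** The seminorm of 1 is not assumed to be 1. Powers of [x] and of [y] contribute one factor [s i 1]
    each, already for exponent 0. *)
Lemma seminorm_ps_partial i D f : s i (ps_partial x y D f) <=
  s i 1 ^+ 2 * ps_norm (Num.max (s i x) (s i y)) D f.
Proof.
have sX a r n : s i a <= r -> s i (a ^+ n) <= s i 1 * r ^+ n.
  have := seminorm_ge0 am i 1; have := seminorm_ge0 am i a => a0 s10 ar.
  elim: n => [|n IH]; first by rewrite !expr0 mulr1.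
  rewrite !exprS mulrCA (le_trans (am_submul am _ _ _))//.
  by rewrite ler_pM// seminorm_ge0.
rewrite /ps_norm -tri_sumZ (le_trans (seminorm_sum am _ _ _ _))//.
apply: ler_sum => d _; rewrite (le_trans (seminorm_sum am _ _ _ _))//.
apply: ler_sum => k _; rewrite (am_scale am) mulrCA ler_wpM2l ?normc_ge0//.
rewrite (le_trans (am_submul am _ _ _))// exprD expr2 mulrACA.
by rewrite ler_pM ?(seminorm_ge0 am)// sX// le_max lexx ?orbT.
Qed.

Lemma ps_partialB D f g :
  ps_partial x y D (ps_sub f g) = ps_partial x y D f - ps_partial x y D g.
Proof.
apply/esym/eqP; rewrite subr_eq -tri_sumD; apply/eqP/eq_tri_sum => i j.
by rewrite -scalerDl subrK.
Qed.

Lemma poly_value_exp_sum h u (w : nat -> A) N :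
  (forall n, poly_value x y (u n) (w n)) ->
  poly_value x y (exp_sum h u N) (\sum_(n < N) (h ^+ n / n`!%:R) *: w n).
Proof.
move=> uw; elim: N => [|N IH]; first by rewrite /exp_sum !big_ord0; apply: poly_value0.
rewrite /exp_sum !big_ord_recr/=; apply: poly_valueD => //.
exact: poly_value_polC.
Qed.

(* Beyond the degree of a partial sum P of [exp_sum h u], [ps_partial x y D]
   maps P to its value, and it maps f - P to an element whose seminorms are
   bounded by tails of an exponential series. *)
Lemma exp_sum_interchange h u (w : nat -> A) f :
  geometric_growth u -> (forall n, poly_value x y (u n) (w n)) ->
  ps_lim (fun N => ps_of_poly (exp_sum h u N)) f ->
  exists2 l, converges_to s (fun N => \sum_(n < N) (h ^+ n / n`!%:R) *: w n) l &
    converges_to s (fun D => ps_partial x y D f) l.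
Proof.
move=> gu uw uf.
(* The degree [D] at which the value is reached depends on [n], but the growth bound applied
   afterwards is uniform in [D]. *)
have sw i n : exists D, s i (w n) <= s i 1 ^+ 2 *
    ps_norm (Num.max (s i x) (s i y)) D (ps_of_poly (u n)).
  have [D HD] := uw n; exists D; rewrite -(HD D (leqnn _)).
  exact: seminorm_ps_partial.
have r0 i : 0 <= Num.max (s i x) (s i y) by rewrite le_max (seminorm_ge0 am).
have [|l wl] := exp_majorized_series am (u := fun n => (h ^+ n / n`!%:R) *: w n).
  move=> i; have [k k0 uk] := gu _ (r0 i).
  exists (s i 1 ^+ 2), (normc h * k); split => [||n].
  - by rewrite exprn_ge0// (seminorm_ge0 am).
  - by rewrite mulr_ge0 ?normc_ge0.
  have [D le_w] := sw i n; rewrite (am_scale am) normc_exp_coef exprMn.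
  have c0 : 0 <= normc h ^+ n / n`!%:R by rewrite divr_ge0// exprn_ge0// normc_ge0.
  apply: le_trans (ler_wpM2l c0 le_w) _; rewrite mulrCA ler_wpM2l//.
    by rewrite exprn_ge0// (seminorm_ge0 am).
  by rewrite [leRHS]mulrAC ler_wpM2l.
exists l => //; apply/(converges_to_le am) => i e e0.
have [k k0 uk] := gu _ (r0 i).
have K0 : 0 <= s i 1 ^+ 2 by rewrite exprn_ge0// (seminorm_ge0 am).
have [N1 H1] := (converges_to_le am _ _).1 wl i (e / 2) ltac:(lra).
have eK : 0 < e / 2 / (s i 1 ^+ 2 + 1) by rewrite !divr_gt0 ?ltr_wpDl.
have [N2 H2] := exp_tail_cvg (normc h * k) eK.
(* The order of choices matters: [N] is fixed first, then [D] is taken beyond the degree of the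
   [N]-th partial sum. *)
set N := maxn N1 N2; have {}H1 := H1 N (leq_maxl _ _).
have {}H2 := H2 N (leq_maxr _ _).
have [D0 HD0] := poly_value_exp_sum h N uw.
exists D0 => D /HD0 DN.
have := am_triangle am i (ps_partial x y D (ps_sub f (ps_of_poly (exp_sum h u N))))
  (ps_partial x y D (ps_of_poly (exp_sum h u N)) - l).
rewrite {1}ps_partialB addrA subrK DN.
have := seminorm_ps_partial i D (ps_sub f (ps_of_poly (exp_sum h u N))).
have := exp_sum_tail D N (r0 i) k0 uk uf.
have := ps_norm_ge0 D (ps_sub f (ps_of_poly (exp_sum h u N))) (r0 i).
move: H2; rewrite ltr_pdivlMr ?ltr_wpDl//.
set a := ps_norm _ _ _; set t := exp_tail _ _; set b := s i 1 ^+ 2 in K0 *.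
move: H1; nra.
Qed.

End ExponentialSums.

(** * Coefficientwise limits and exponentials of shifted variables *)

Section PowerSeriesLimits.
Variable R : realType.
Notation C := R[i].
Notation X := (polX R).
Notation Y := (polY R).
Implicit Types (P Q : {poly {poly C}}) (f g : ps R).

Let amC := @cmodulus_arens_michael R.

Lemma ps_lim_unique u f g : ps_lim u f -> ps_lim u g -> f = g.
Proof.
move=> uf ug; apply/funext => i; apply/funext => j.
exact: (converges_to_unique amC (uf i j) (ug i j)).
Qed.

Lemma ps_limD u v f g : ps_lim u f -> ps_lim v g ->
  ps_lim (fun N => ps_add (u N) (v N)) (ps_add f g).
Proof. by move=> uf vg i j; apply: (converges_toD amC (uf i j) (vg i j)). Qed.

Lemma ps_limMl P u f : ps_lim u f ->
  ps_lim (fun N => ps_mul (ps_of_poly P) (u N)) (ps_mul (ps_of_poly P) f).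
Proof.
move=> uf i j; rewrite /ps_mul.
apply: (converges_to_sum amC _ _ (u := fun (k : 'I_i.+1) N =>
  \sum_(l < j.+1) ps_of_poly P k l * u N (i - k)%N (j - l)%N : R[i]^o)) => k.
apply: (converges_to_sum amC _ _ (u := fun (l : 'I_j.+1) N =>
  ps_of_poly P k l * u N (i - k)%N (j - l)%N : R[i]^o)) => l.
exact: (converges_toMl amC).
Qed.

Lemma ps_mul_polC c f i j : ps_mul (ps_of_poly (polC c)) f i j = c * f i j.
Proof.
have iN : (i < (maxn i j).+1)%N by rewrite ltnS leq_maxl.
have jN : (j < (maxn i j).+1)%N by rewrite ltnS leq_maxr.
by rewrite (ps_mul_trunc _ _ iN jN) coef_polCM coef_ps_trunc.
Qed.

Lemma ps_mul1 f : ps_mul (ps_of_poly 1) f = f.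
Proof.
apply/funext => i; apply/funext => j.
by rewrite -[1 : {poly {poly C}}]/(polC 1) ps_mul_polC mul1r.
Qed.

Lemma ps_mulDl P Q f : ps_mul (ps_of_poly (P + Q)) f =
  ps_add (ps_mul (ps_of_poly P) f) (ps_mul (ps_of_poly Q) f).
Proof.
apply/funext => i; apply/funext => j.
rewrite /ps_add /ps_mul -big_split; apply: eq_bigr => k _.
rewrite -big_split; apply: eq_bigr => l _.
by rewrite /ps_of_poly !coefD mulrDl.
Qed.

Lemma ps_mulNl P f i j : ps_mul (ps_of_poly (- P)) f i j =
  - ps_mul (ps_of_poly P) f i j.
Proof.
rewrite -mulN1r -polC1 -polCN ps_mulA ps_mul_polC.
by rewrite mulN1r.
Qed.

Lemma cexp_cvg (z : C) :
  converges_to (@cmodulus R) (fun N => \sum_(n < N) z ^+ n / n`!%:R : R[i]^o) (cexp z).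
Proof.
have [|l zl] := exp_majorized_series amC (u := fun n => z ^+ n / n`!%:R : R[i]^o).
  move=> i; exists 1, (normc z); split=> // [|n]; first exact: normc_ge0.
  by rewrite /cmodulus normc_exp_coef mul1r.
suff -> : cexp z = l by [].
apply: (series_sumE amC); congr (converges_to _ _ _): zl.
apply/funext => N; apply: eq_bigr => n _; rewrite mulrC; reflexivity.
Qed.

Lemma cexp_shift_cvg (k z : C) i : converges_to (@cmodulus R)
  (fun N => k * \sum_(n < N - i) z ^+ n / n`!%:R : R[i]^o) (cexp z * k).
Proof.
have := converges_toMl amC k (converges_to_shift amC i (cexp_cvg z)).
by rewrite [X in converges_to _ _ X]mulrC.
Qed.

Lemma cexp0 : cexp (0 : C) = 1.
Proof.
apply: (converges_to_unique amC (cexp_cvg 0)).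
apply: (converges_to_eventually amC (converges_to_cst amC 1)).
exists 1%N => -[|N]// _; rewrite big_ord_recl big1 => [|n _].
  by rewrite addr0 expr0 divr1.
by rewrite exprS !mul0r.
Qed.

Lemma coef_XaddCn (S : comNzRingType) (a : S) n i :
  (('X + a%:P) ^+ n)`_i = a ^+ (n - i) *+ 'C(n, i).
Proof.
rewrite addrC exprDn coef_sum.
under eq_bigr => k _ do rewrite coefMn -rmorphXn coefCM coefXn.
have [ni|] := ltnP n i.
  rewrite bin_small// big1// => k _; rewrite gtn_eqF ?mulr0 ?mul0rn//.
  by rewrite (leq_trans _ ni)// ltnS -ltnS.
rewrite -ltnS => iSn; rewrite (bigD1 (Ordinal iSn))//= eqxx mulr1.
rewrite big1 ?addr0// => k /negPf; rewrite -val_eqE/= => ki.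
by rewrite eq_sym ki mulr0 mul0rn.
Qed.

(** Terms with n < i vanish; in the others n! cancels against the binomial coefficient, leaving i!
    (n - i)!. The truncated [N - i] also covers N < i. *)
Lemma sum_exp_binomial (h c : C) i N :
  \sum_(n < N) h ^+ n / n`!%:R * (c ^+ (n - i) *+ 'C(n, i)) =
  h ^+ i / i`!%:R * \sum_(m < N - i) (h * c) ^+ m / m`!%:R.
Proof.
have fact_neq0 n : n`!%:R != 0 :> C by rewrite pnatr_eq0 -lt0n fact_gt0.
elim: N => [|N IH]; first by rewrite sub0n !big_ord0 mulr0.
rewrite big_ord_recr/= IH; have [Ni|iN] := ltnP N i.
  rewrite bin_small// mulr0n mulr0 addr0.
  by have [/eqP-> /eqP->] : (N - i == 0)%N /\ (N.+1 - i == 0)%N by rewrite !subn_eq0 ltnW.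
rewrite subSn// big_ord_recr/= mulrDr; congr (_ + _).
have := bin_fact iN; move/(congr1 (fun n => n%:R : C)); rewrite !natrM.
rewrite -[c ^+ _ *+ _]mulr_natr => <-.
have bin0 : 'C(N, i)%:R != 0 :> C by rewrite pnatr_eq0 -lt0n bin_gt0.
rewrite -{1}(subnKC iN) exprD exprMn; field.
by rewrite !fact_neq0 bin0.
Qed.

(** This is e^(h(X + c)) = e^(hc) e^(hX), read off coefficient by coefficient from the binomial
    formula. *)
Lemma ps_lim_exp_sum_X (h c : C) :
  ps_lim (fun N => ps_of_poly (exp_sum h (fun n => (X + polC c) ^+ n) N))
    (ps_mul (ps_of_poly (polC (cexp (h * c)))) (ps_expX h)).
Proof.
move=> i j; rewrite ps_mul_polC /ps_expX.
have -> : (fun N => ps_of_poly (exp_sum h (fun n => (X + polC c) ^+ n) N) i j : R[i]^o) =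
    fun N => (if j == 0%N then h ^+ i / i`!%:R else 0) *
      \sum_(m < N - i) (h * c) ^+ m / m`!%:R.
  apply/funext => N; rewrite /ps_of_poly coef_exp_sum.
  under eq_bigr => n _ do rewrite /polX /polC -rmorphD -rmorphXn coefC.
  case: eqP => _; last by rewrite mul0r big1// => n _; rewrite coef0 mulr0.
  by rewrite -sum_exp_binomial; apply: eq_bigr => n _; rewrite coef_XaddCn.
exact: cexp_shift_cvg.
Qed.

Lemma ps_lim_exp_sum_Y (h c : C) :
  ps_lim (fun N => ps_of_poly (exp_sum h (fun n => (Y + polC c) ^+ n) N))
    (ps_mul (ps_of_poly (polC (cexp (h * c)))) (ps_expY h)).
Proof.
move=> i j; rewrite ps_mul_polC /ps_expY.
have -> : (fun N => ps_of_poly (exp_sum h (fun n => (Y + polC c) ^+ n) N) i j : R[i]^o) =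
    fun N => (if i == 0%N then h ^+ j / j`!%:R else 0) *
      \sum_(m < N - j) (h * c) ^+ m / m`!%:R.
  apply/funext => N; rewrite /ps_of_poly coef_exp_sum.
  under eq_bigr => n _ do rewrite /polY coef_XaddCn coefMn -rmorphXn coefC.
  case: eqP => _; last by rewrite mul0r big1// => n _; rewrite mul0rn mulr0.
  by rewrite -sum_exp_binomial.
exact: cexp_shift_cvg.
Qed.

(** The interchange of summations is applied in the complex numbers themselves, at the point (a, 0),
    to the powers of X + b: one order of summation gives e^(a + b), the other e^b e^a. *)
Lemma cexpD (a b : C) : cexp (a + b) = cexp a * cexp b.
Proof.
have growth : geometric_growth (fun n => (X + polC b) ^+ n : {poly {poly C}}).
  exact/geometric_growthX/mul_boundedDC/mul_bounded_polX.
have value n : poly_value (a : R[i]^o) 0 ((X + polC b) ^+ n) ((a + b : R[i]^o) ^+ n).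
  have := poly_value_exp n (mul_valueDC b (@mul_valueX R R[i]^o a 0)).
  by rewrite -[b%:A]/(b * 1) mulr1.
have [l suml partl] := exp_sum_interchange amC growth value (ps_lim_exp_sum_X 1 b).
have -> : cexp (a + b) = l.
  apply: (converges_to_unique amC (cexp_cvg (a + b))).
  congr (converges_to _ _ _): suml; apply/funext => N; apply: eq_bigr => n _.
  by rewrite expr1n mul1r mulrC.
apply: (converges_to_unique amC partl).
have -> : (ps_partial (a : R[i]^o) 0)^~
    (ps_mul (ps_of_poly (polC (cexp (1 * b)))) (ps_expX 1)) =
    fun D => cexp b * \sum_(n < D) a ^+ n / n`!%:R.
  apply/funext => D; rewrite mulr_sumr; apply: eq_bigr => d _.
  (* In total degree [d] only the last term survives, because [ps_expX] contains no positive power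
     of Y. *)
  rewrite big_ord_recr/= big1 => [|k _]; last first.
    by rewrite ps_mul_polC /ps_expX subn_eq0 leqNgt ltn_ord/= mulr0 scale0r.
  rewrite add0r ps_mul_polC /ps_expX subnn expr0 mulr1 mul1r expr1n mul1r.
  by rewrite eqxx -[LHS]/(_ * _ : R[i]) -mulrA; congr (_ * _); apply: mulrC.
move: (cexp_cvg a); move: (cexp a) (cexp b) => ea eb ea_cvg.
by rewrite (mulrC ea); apply: (converges_toMl amC eb ea_cvg).
Qed.

(** Common mechanism for the four quotients: once [G] clears the denominator of [u n], leaving
    powers of X, Y and their shifts, the product of [G] with the exponential sum is the same
    combination of exponentials. *)
Lemma ps_mul_lim_exp (h : C) G u f (W1 W2 W3 W4 : {poly {poly C}}) c1 c3 e1 e3 :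
  cexp (h * c1) = e1 -> cexp (h * c3) = e3 ->
  (forall n, G * u n = W1 * (X + polC c1) ^+ n + W2 * X ^+ n +
    (W3 * (Y + polC c3) ^+ n + W4 * Y ^+ n)) ->
  ps_lim (fun N => ps_of_poly (exp_sum h u N)) f ->
  ps_mul (ps_of_poly G) f =
  ps_add (ps_mul (ps_of_poly (W1 * polC e1 + W2)) (ps_expX h))
    (ps_mul (ps_of_poly (W3 * polC e3 + W4)) (ps_expY h)).
Proof.
move=> ce1 ce3 Gu uf; apply: ps_lim_unique (ps_limMl G uf) _.
have limX := ps_lim_exp_sum_X h 0; have limY := ps_lim_exp_sum_Y h 0.
rewrite mulr0 cexp0 ps_mul1 polC0 addr0 in limX.
rewrite mulr0 cexp0 ps_mul1 polC0 addr0 in limY.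
have limX1 := ps_lim_exp_sum_X h c1; have limY3 := ps_lim_exp_sum_Y h c3.
rewrite {}ce1 in limX1; rewrite {}ce3 in limY3.
rewrite !ps_mulDl !ps_mulA.
have lim := ps_limD (ps_limD (ps_limMl W1 limX1) (ps_limMl W2 limX))
  (ps_limD (ps_limMl W3 limY3) (ps_limMl W4 limY)).
move=> i j; congr (converges_to _ _ _): (lim i j); apply/funext => N.
suff GE : G * exp_sum h u N =
    W1 * exp_sum h (fun n => (X + polC c1) ^+ n) N + W2 * exp_sum h (GRing.exp X) N +
    (W3 * exp_sum h (fun n => (Y + polC c3) ^+ n) N + W4 * exp_sum h (GRing.exp Y) N).
  by rewrite -(ps_of_polyM G) GE !ps_of_polyD !ps_of_polyM.
rewrite /exp_sum !mulr_sumr -!big_split; apply: eq_bigr => n _.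
by rewrite mulrCA Gu !mulrDr; congr (_ + _ + (_ + _)); apply: mulrCA.
Qed.

End PowerSeriesLimits.

(** * The quotients as limits *)

(** First divided difference of z^n at [a], [b], with the denominator cleared so that [a - b] need
    not be invertible. *)
Lemma affine_iter_geometric (S : comPzRingType) (a b : S) n :
  (a - b) * affine_iter a (GRing.exp b) n = a ^+ n - b ^+ n.
Proof.
elim: n => [|n IH] /=; first by rewrite mulr0 !expr0 subrr.
by rewrite mulrDr mulrCA IH !exprS; ring.
Qed.

(** Second divided difference of z^n at [a], [b], [c], multiplied by the Vandermonde product of the
    nodes. *)
Lemma affine_iter_geometric2 (S : comPzRingType) (a b c : S) n :
  (a - b) * (b - c) * (a - c) * affine_iter a (affine_iter b (GRing.exp c)) n =
  a ^+ n * (b - c) - b ^+ n * (a - c) + c ^+ n * (a - b).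
Proof.
elim: n => [|n IH] /=; first by rewrite mulr0 !expr0; ring.
rewrite mulrDr mulrCA IH.
rewrite [X in _ + X](_ : _ =
    (a - b) * (a - c) * ((b - c) * affine_iter b (GRing.exp c) n)); last by ring.
by rewrite affine_iter_geometric !exprS; ring.
Qed.

Section Quotients.
Variables (R : realType) (h phi vphi p q : R[i]).
Notation C := R[i].
Notation X := (polX R).
Notation Y := (polY R).
Implicit Types (f g Q : ps R).
Hypothesis phi_vphi : phi + vphi = 2.
Hypothesis cexp_phi : cexp (h * phi) = q.
Hypothesis cexp_vphi : cexp (h * vphi) = p.

Let t : ps R := ps_sub ps_X ps_Y.
Let eX := ps_expX h.
Let eY := ps_expY h.

(** Turns differences into sums with polynomial coefficients, the shape produced by
    [ps_mul_lim_exp]. *)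
Lemma ps_sub_mulE f P g :
  ps_sub f (ps_mul (ps_of_poly P) g) = ps_add f (ps_mul (ps_of_poly (- P)) g).
Proof. by apply/funext => i; apply/funext => j; rewrite /ps_add ps_mulNl. Qed.

Lemma ps_addC f g : ps_add f g = ps_add g f.
Proof. by apply/funext => i; apply/funext => j; rewrite /ps_add addrC. Qed.

Let tE : t = ps_of_poly (X - Y).
Proof. by rewrite ps_of_polyB ps_of_polX ps_of_polY. Qed.

Let cexp_h0 : cexp (h * 0) = 1.
Proof. by rewrite mulr0 cexp0. Qed.

(** The denominator is the difference of the nodes X + phi and Y; the shift by phi produces the
    factor q = e^(h phi). *)
Lemma ps_div_beta Q :
  ps_lim (fun N => ps_of_poly (exp_sum h
    (affine_iter (X + polC phi) (GRing.exp Y)) N)) Q ->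
  ps_div (ps_sub (ps_mul (ps_const q) eX) eY) (ps_add t (ps_const phi)) = Q.
Proof.
move=> limQ; rewrite tE -!ps_of_polC -ps_of_polyD -[eY]ps_mul1 ps_sub_mulE.
apply: ps_div_unique.
  have := @ps_regular_linear _ 1 phi (oner_neq0 _).
  by rewrite polC1 mul1r.
rewrite (ps_mul_lim_exp (W1 := 1) (W2 := 0) (W3 := 0) (W4 := - 1) cexp_phi cexp_h0 _ limQ) => [|n].
  by congr (ps_add (ps_mul (ps_of_poly _) _) (ps_mul (ps_of_poly _) _)); ring.
by rewrite addrAC affine_iter_geometric; ring.
Qed.

(** Here the nodes are Y + vphi and X, with difference vphi - (X - Y). *)
Lemma ps_div_gamma Q :
  ps_lim (fun N => ps_of_poly (exp_sum h
    (affine_iter (Y + polC vphi) (GRing.exp X)) N)) Q ->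
  ps_div (ps_sub (ps_mul (ps_const p) eY) eX) (ps_sub (ps_const vphi) t) = Q.
Proof.
move=> limQ; rewrite tE -!ps_of_polC -ps_of_polyB -[eX]ps_mul1 ps_sub_mulE.
apply: ps_div_unique.
  have := @ps_regular_linear _ (-1) vphi; rewrite oppr_eq0 oner_neq0 => /(_ isT).
  by rewrite polCN polC1 mulN1r addrC.
rewrite (ps_mul_lim_exp (W1 := 0) (W2 := - 1) (W3 := 1) (W4 := 0) cexp_h0 cexp_vphi _ limQ) => [|n].
  rewrite ps_addC.
  by congr (ps_add (ps_mul (ps_of_poly _) _) (ps_mul (ps_of_poly _) _)); ring.
rewrite (_ : polC vphi - _ = Y + polC vphi - X); last by ring.
by rewrite affine_iter_geometric; ring.
Qed.

Let polC2 : polC 2 = 2 :> {poly {poly C}}.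
Proof. by rewrite /polC !rmorph_nat. Qed.

Let half : polC 2^-1 * 2 = 1 :> {poly {poly C}}.
Proof.
by rewrite -[X in _ * X]polC2 -polCM (@mulVf C) ?pnatr_eq0// polC1.
Qed.

Let phiE : polC phi = 2 - polC vphi :> {poly {poly C}}.
Proof.
have -> : phi = 2 - vphi by rewrite -phi_vphi addrK.
by rewrite polCD polCN polC2.
Qed.

Let cexp_pq : cexp (h * 2) = p * q.
Proof. by rewrite -phi_vphi addrC mulrDr cexpD cexp_vphi cexp_phi. Qed.

Let denominator_regular :
  ps_regular ((X - Y + polC phi) * (X - Y - polC vphi)).
Proof.
apply: ps_regularM.
  have := @ps_regular_linear _ 1 phi (oner_neq0 _).
  by rewrite polC1 mul1r.
have := @ps_regular_linear _ 1 (- vphi) (oner_neq0 _).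
by rewrite polC1 mul1r polCN.
Qed.

(** The nodes are X + 2, Y + vphi and X. As phi + vphi = 2, their differences are t + phi, -(t -
    vphi) and 2, so the Vandermonde product is -2 times the denominator; this accounts for the sign
    and for the halves. The shift by 2 gives e^(2h) = pq. *)
Lemma ps_div_a Q :
  ps_lim (fun N => ps_of_poly (exp_sum h (fun n => polC (- 1) *
    affine_iter (X + polC 2) (affine_iter (Y + polC vphi) (GRing.exp X)) n) N)) Q ->
  ps_div
    (ps_sub (ps_mul (ps_sub (ps_const ((phi + p * q * vphi) / 2))
                            (ps_mul (ps_const ((p * q - 1) / 2)) t)) eX)
            (ps_mul (ps_const p) eY))
    (ps_mul (ps_add t (ps_const phi)) (ps_sub t (ps_const vphi))) = Q.
Proof.
move=> limQ; rewrite tE -!ps_of_polC -!ps_of_polyM -!ps_of_polyB -ps_of_polyD -ps_of_polyM.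
rewrite ps_sub_mulE; apply: ps_div_unique; first exact: denominator_regular.
rewrite (ps_mul_lim_exp (W1 := - polC 2^-1 * (X - Y - polC vphi))
  (W2 := polC 2^-1 * (X - Y + polC phi)) (W3 := - (polC 2^-1 * 2)) (W4 := 0)
  cexp_pq cexp_vphi _ limQ) => [|n].
  congr (ps_add (ps_mul (ps_of_poly _) _) (ps_mul (ps_of_poly _) _)).
    by rewrite !(polCM, polCD, polCN) polC1; ring.
  by rewrite half; ring.
have := affine_iter_geometric2 (X + polC 2) (Y + polC vphi) (X : {poly {poly C}}) n.
move: (affine_iter _ _ n) => r E.
(* Inserting 2^-1 * 2 = 1 completes the denominator to the Vandermonde product of the nodes. *)
transitivity (polC 2^-1 * ((X + polC 2 - (Y + polC vphi)) *
    (Y + polC vphi - X) * (X + polC 2 - X) * r)).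
  rewrite -[LHS]mul1r -half polC2 phiE polCN polC1; ring.
by rewrite E polC2 phiE; ring.
Qed.

(** Same computation with nodes Y + 2, X + phi and Y, whose differences are -(t - vphi), t + phi and
    2. *)
Lemma ps_div_d Q :
  ps_lim (fun N => ps_of_poly (exp_sum h (fun n => polC (- 1) *
    affine_iter (Y + polC 2) (affine_iter (X + polC phi) (GRing.exp Y)) n) N)) Q ->
  ps_div
    (ps_sub (ps_mul (ps_add (ps_const ((vphi + p * q * phi) / 2))
                            (ps_mul (ps_const ((p * q - 1) / 2)) t)) eY)
            (ps_mul (ps_const q) eX))
    (ps_mul (ps_add t (ps_const phi)) (ps_sub t (ps_const vphi))) = Q.
Proof.
move=> limQ; rewrite tE -!ps_of_polC -!ps_of_polyM -!ps_of_polyB -!ps_of_polyD -ps_of_polyM.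
rewrite ps_sub_mulE ps_addC; apply: ps_div_unique; first exact: denominator_regular.
rewrite (ps_mul_lim_exp (W1 := - (polC 2^-1 * 2)) (W2 := 0)
  (W3 := polC 2^-1 * (X - Y + polC phi))
  (W4 := - polC 2^-1 * (X - Y - polC vphi)) cexp_phi cexp_pq _ limQ) => [|n].
  congr (ps_add (ps_mul (ps_of_poly _) _) (ps_mul (ps_of_poly _) _)).
    by rewrite half; ring.
  by rewrite !(polCM, polCD, polCN) polC1; ring.
have := affine_iter_geometric2 (Y + polC 2) (X + polC phi) (Y : {poly {poly C}}) n.
move: (affine_iter _ _ n) => r E.
transitivity (polC 2^-1 * ((Y + polC 2 - (X + polC phi)) *
    (X + polC phi - Y) * (Y + polC 2 - Y) * r)).
  rewrite -[LHS]mul1r -half polC2 phiE polCN polC1; ring.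
by rewrite E polC2 phiE; ring.
Qed.

End Quotients.

(** * Powers of the matrix *)

Section MatrixPowers.
Variables (R : realType) (A : algType R[i]) (x mu nu y : A) (phi vphi : R[i]).
Hypotheses (phi_vphi : phi + vphi = 2).
Hypotheses (x_mu : x * mu = mu * (x + phi%:A)) (y_mu : y * mu = mu * (y + phi%:A)).
Hypotheses (x_nu : x * nu = nu * (x + vphi%:A)) (y_nu : y * nu = nu * (y + vphi%:A)).
Hypotheses (mu_mu : mu * mu = 0) (nu_nu : nu * nu = 0) (mu_nu : mu * nu = - (nu * mu)).

Let nu_mu : nu * mu = - (mu * nu).
Proof. by rewrite mu_nu opprK. Qed.

Lemma mx22_mul (a b c d a' b' c' d' : A) :
  mx22 a b c d * mx22 a' b' c' d' =
  mx22 (a * a' + b * c') (a * b' + b * d') (c * a' + d * c') (c * b' + d * d').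
Proof.
apply/matrixP => i j; rewrite !mxE !big_ord_recl big_ord0 addr0 !mxE.
by case: i j => [[|[|i]] // ilt] [[|[|j]] // jlt].
Qed.

Lemma mx22P (M : 'M[A]_2) (a b c d : A) :
  M 0 0 = a -> M 0 1 = b -> M 1 0 = c -> M 1 1 = d -> M = mx22 a b c d.
Proof.
move=> <- <- <- <-; apply/matrixP => i j; rewrite mxE.
by case: i j => [[|[|i]] // ilt] [[|[|j]] // jlt]; congr (M _ _); apply: val_inj.
Qed.

(** Induction on [M ^+ n.+1 = M * M ^+ n]. Moving [x] or [y] past both [mu] and [nu] shifts it by
    phi + vphi = 2, which is where the outer node shifted by 2 comes from. *)
Lemma mx22_exp n : mx22 x mu nu y ^+ n = mx22
  (x ^+ n + mu * nu * affine_iter (x + 2%:A)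
     (affine_iter (y + vphi%:A) (GRing.exp x)) n)
  (mu * affine_iter (x + phi%:A) (GRing.exp y) n)
  (nu * affine_iter (y + vphi%:A) (GRing.exp x) n)
  (y ^+ n + nu * mu * affine_iter (y + 2%:A)
     (affine_iter (x + phi%:A) (GRing.exp y)) n).
Proof.
elim: n => [|n IH].
  rewrite !expr0 /= !mulr0 !addr0; apply/matrixP => i j; rewrite !mxE.
  by case: i j => [[|[|i]] // ilt] [[|[|j]] // jlt].
have shift (z l m : A) k k' : z * l = l * (z + k%:A) -> z * m = m * (z + k'%:A) ->
    z * (m * l) = m * l * (z + (k' + k)%:A).
  move=> zl zm; rewrite mulrA zm -!mulrA; congr (m * _).
  rewrite mulrDl zl -scalerAl mul1r !mulrDr -!scalerAr !mulr1 scalerDl.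
  by rewrite -!addrA [k *: l + _]addrC.
have x_mu_nu := shift _ _ _ _ _ x_nu x_mu.
have y_nu_mu := shift _ _ _ _ _ y_mu y_nu.
rewrite phi_vphi in x_mu_nu; rewrite [vphi + _]addrC phi_vphi in y_nu_mu.
rewrite exprS IH mx22_mul /=; congr mx22.
- rewrite mulrDr -exprS -addrA (mulrA x) x_mu_nu (mulrA mu nu).
  by rewrite -(mulrA (mu * nu)) -mulrDr.
(* The contribution of [mu * (nu * mu)] vanishes: anticommuting the first two factors creates
   [mu * mu]. The next entry is treated symmetrically. *)
- rewrite (mulrA x) x_mu (mulrDr mu (y ^+ n)) -!mulrA (mulrA mu nu) mu_nu mulNr -!mulrA.
  by rewrite (mulrA mu mu) mu_mu mul0r mulr0 oppr0 addr0 -mulrDr.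
- rewrite (mulrA y) y_nu (mulrDr nu (x ^+ n)) -!mulrA (mulrA nu mu) nu_mu mulNr -!mulrA.
  by rewrite (mulrA nu nu) nu_nu mul0r mulr0 oppr0 addr0 addrC -mulrDr.
- rewrite mulrDr -exprS addrCA (mulrA y) y_nu_mu (mulrA nu mu).
  by rewrite -(mulrA (nu * mu)) -mulrDr [affine_iter (x + _) _ n + _]addrC.
Qed.

End MatrixPowers.

(** * Summation of the entries in the algebra *)

Lemma exp_series_ps_eval (R : realType) (A : algType R[i]) (I : Type)
    (s : I -> A -> R) (x y : A) (h : R[i]) u w f :
  arens_michael s -> geometric_growth u -> (forall n, poly_value x y (u n) (w n)) ->
  ps_lim (fun N => ps_of_poly (exp_sum h u N)) f ->
  converges_to s (fun N => \sum_(n < N) (h ^+ n / n`!%:R) *: w n) (ps_eval s f x y).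
Proof.
move=> am gu uw uf; have [l suml partl] := exp_sum_interchange am gu uw uf.
suff -> : ps_eval s f x y = l by [].
exact: (series_sumE am).
Qed.

Lemma exp_series_alg_exp (R : realType) (A : algType R[i]) (I : Type)
    (s : I -> A -> R) (h : R[i]) (x : A) : arens_michael s ->
  converges_to s (fun N => \sum_(n < N) (h ^+ n / n`!%:R) *: x ^+ n) (alg_exp s (h *: x)).
Proof.
move=> am.
have growth : geometric_growth (GRing.exp (polX R)).
  exact/geometric_growthX/mul_bounded_polX.
have [f uf] := ps_lim_exp_sum h growth.
(* Powers of [x] are values of powers of X at (x, 0). *)
have value n := poly_value_exp n (@mul_valueX R A x 0).
have [l suml _] := exp_sum_interchange am growth value uf.
suff -> : alg_exp s (h *: x) = l by [].
apply: (series_sumE am); congr (converges_to _ _ _): suml; apply/funext => N.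
by apply: eq_bigr => n _; rewrite exprZn scalerA mulrC.
Qed.

Lemma geometric_growthZ (R : realType) (c : R[i]) u : normc c = 1 ->
  geometric_growth u -> geometric_growth (fun n => polC c * u n).
Proof.
move=> c1 gu r r0; have [k k0 uk] := gu r r0.
by exists k => // n D; rewrite ps_norm_polC c1 mul1r.
Qed.

Theorem lemma4p4 (R : realType) (A : algType R[i]) (I : Type)
    (s : I -> A -> R) (h1 h2 : R[i]) (x mu nu y : A) :
  arens_michael s ->
  (h1 + h2) / 2 != 0 ->
  in_M h1 h2 x mu nu y ->
  let q := cexp h1 in
  let p := cexp h2 in
  let h := (h1 + h2) / 2 in
  let phi := h1 / h in
  let vphi := h2 / h in
  let t : ps R := (ps_X - ps_Y)%PS in
  let eX := ps_expX h in
  let eY := ps_expY h in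
  let Qa : ps R :=
    (((((phi + p * q * vphi) / 2)%R%:PS - ((p * q - 1) / 2)%R%:PS * t) * eX
       - p%:PS * eY)
     / ((t + phi%:PS) * (t - vphi%:PS)))%PS in
  let Qd : ps R :=
    (((((vphi + p * q * phi) / 2)%R%:PS + ((p * q - 1) / 2)%R%:PS * t) * eY
       - q%:PS * eX)
     / ((t + phi%:PS) * (t - vphi%:PS)))%PS in
  let Qb : ps R := ((q%:PS * eX - eY) / (t + phi%:PS))%PS in
  let Qc : ps R := ((p%:PS * eY - eX) / (vphi%:PS - t))%PS in
  let a := alg_exp s (h *: x) - mu * nu * ps_eval s Qa x y in
  let d := alg_exp s (h *: y) - nu * mu * ps_eval s Qd x y in
  let beta := mu * ps_eval s Qb x y in
  let gamma := nu * ps_eval s Qc x y in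
  mx_exp s h (mx22 x mu nu y) = mx22 a beta gamma d.
Proof.
move=> am h_neq0 [x_mu y_mu mu2 x_nu y_nu nu2 xy mu_nu] q p h phi vphi t eX eY.
move=> Qa Qd Qb Qc a d beta gamma.
have h12 : h1 + h2 != 0 by apply: contraNneq h_neq0 => ->; rewrite mul0r.
have phi_vphi : phi + vphi = 2 by rewrite /phi /vphi /h; field.
have cexp_phi : cexp (h * phi) = q by congr cexp; rewrite mulrC divfK.
have cexp_vphi : cexp (h * vphi) = p by congr cexp; rewrite mulrC divfK.
have {}xy : x * y = y * x by apply/eqP; rewrite -subr_eq0 xy.
have {}mu_nu : mu * nu = - (nu * mu) by apply/eqP; rewrite -addr_eq0 mu_nu.
have phiE : 2 * h1 / (h1 + h2) = phi by rewrite /phi /h; field.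
have vphiE : 2 * h2 / (h1 + h2) = vphi by rewrite /vphi /h; field.
(* A commutator relation is recast as moving [m] to the left of [z] while [z] is shifted by [k]. *)
have comm (z m : A) k : z * m - m * z = k *: m -> z * m = m * (z + k%:A).
  by move=> /eqP; rewrite subr_eq mulrDr -scalerAr mulr1 addrC => /eqP.
have {}x_mu := comm _ _ _ x_mu; have {}y_mu := comm _ _ _ y_mu.
have {}x_nu := comm _ _ _ x_nu; have {}y_nu := comm _ _ _ y_nu.
rewrite phiE in x_mu y_mu; rewrite vphiE in x_nu y_nu.
have powM := mx22_exp phi_vphi x_mu y_mu x_nu y_nu mu2 nu2 mu_nu.
have bX c : mul_bounded (polX R + polC c) by apply/mul_boundedDC/mul_bounded_polX.
have bY c : mul_bounded (polY R + polC c) by apply/mul_boundedDC/mul_bounded_polY.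
have vX c : mul_value x y (polX R + polC c) (x + c%:A) by apply/mul_valueDC/mul_valueX.
have vY c : mul_value x y (polY R + polC c) (y + c%:A) by apply/mul_valueDC/mul_valueY.
have gX : geometric_growth (GRing.exp (polX R)).
  exact/geometric_growthX/mul_bounded_polX.
have gY : geometric_growth (GRing.exp (polY R)).
  exact/geometric_growthX/mul_bounded_polY.
have powX n := poly_value_exp n (@mul_valueX R A x y).
have powY n := poly_value_exp n (@mul_valueY R A x y xy).
pose ub := affine_iter (polX R + polC phi) (GRing.exp (polY R)).
pose uc := affine_iter (polY R + polC vphi) (GRing.exp (polX R)).
(* The factor -1 matches the minus sign in front of the quotients for [a] and [d]: the powers of the
   matrix carry these terms with a plus sign. *)
pose ua n := polC (-1) * affine_iter (polX R + polC 2) uc n.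
pose ud n := polC (-1) * affine_iter (polY R + polC 2) ub n.
pose wb := affine_iter (x + phi%:A) (GRing.exp y).
pose wc := affine_iter (y + vphi%:A) (GRing.exp x).
pose wa n := (-1) *: affine_iter (x + 2%:A) wc n.
pose wd n := (-1) *: affine_iter (y + 2%:A) wb n.
have norm1 : normc (-1 : R[i]) = 1 by rewrite normcN normc1.
have gb : geometric_growth ub by apply: geometric_growth_affine_iter.
have gc : geometric_growth uc by apply: geometric_growth_affine_iter.
have ga : geometric_growth ua.
  exact/(geometric_growthZ norm1)/geometric_growth_affine_iter.
have gd : geometric_growth ud.
  exact/(geometric_growthZ norm1)/geometric_growth_affine_iter.
have vb n : poly_value x y (ub n) (wb n) by apply: poly_value_affine_iter.
have vc n : poly_value x y (uc n) (wc n) by apply: poly_value_affine_iter.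
have va n : poly_value x y (ua n) (wa n).
  by apply/poly_value_polC/poly_value_affine_iter.
have vd n : poly_value x y (ud n) (wd n).
  by apply/poly_value_polC/poly_value_affine_iter.
(* Growth alone provides a formal limit [f]; the division lemmas identify it with the quotient [Q],
   so the divisions are exact and the default of [ps_div] never occurs. *)
have evaluate u w Q : geometric_growth u -> (forall n, poly_value x y (u n) (w n)) ->
    (forall f, ps_lim (fun N => ps_of_poly (exp_sum h u N)) f -> Q = f) ->
    converges_to s (fun N => \sum_(n < N) (h ^+ n / n`!%:R) *: w n) (ps_eval s Q x y).
  move=> gu uw QE; have [f uf] := ps_lim_exp_sum h gu; rewrite (QE f uf).
  exact: exp_series_ps_eval uf.
have cb := evaluate _ _ Qb gb vb (ps_div_beta cexp_phi).
have cc := evaluate _ _ Qc gc vc (ps_div_gamma cexp_vphi).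
have ca := evaluate _ _ Qa ga va (ps_div_a phi_vphi cexp_phi cexp_vphi).
have cd := evaluate _ _ Qd gd vd (ps_div_d phi_vphi cexp_phi cexp_vphi).
have offdiag (m l : A) (w : nat -> A) :
    converges_to s (fun N => \sum_(n < N) (h ^+ n / n`!%:R) *: w n) l ->
    series_sum s (fun n => (h ^+ n / n`!%:R) *: (m * w n)) = m * l.
  move=> /(converges_toMl am m) cw; apply: (series_sumE am).
  congr (converges_to _ _ _): cw; apply/funext => N; rewrite mulr_sumr.
  by apply: eq_bigr => n _; rewrite scalerAr.
have diag (z m l : A) (w : nat -> A) :
    converges_to s (fun N => \sum_(n < N) (h ^+ n / n`!%:R) *: ((-1) *: w n)) l ->
    series_sum s (fun n => (h ^+ n / n`!%:R) *: (z ^+ n + m * w n)) =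
    alg_exp s (h *: z) - m * l.
  move=> /(converges_toMl am m)/(converges_toN am) cw; apply: (series_sumE am).
  congr (converges_to _ _ _): (converges_toD am (exp_series_alg_exp h z am) cw).
  apply/funext => N; rewrite mulr_sumr -sumrN -big_split; apply: eq_bigr => n _.
  by rewrite scaleN1r scalerN mulrN opprK scalerDr scalerAr.
apply: mx22P; rewrite mxE; under eq_fun => n do rewrite powM mxE /=.
- exact: (diag x (mu * nu) _ (affine_iter (x + 2%:A) wc) ca).
- exact: (offdiag mu _ wb cb).
- exact: (offdiag nu _ wc cc).
- exact: (diag y (nu * mu) _ (affine_iter (y + 2%:A) wb) cd).
Qed.
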